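(* Let $\Phi$ be an Orlicz function and $\Lambda>1$. Then there exists a constant $C=C(\Phi,\Lambda)>0$, depending only on $\Phi$ and $\Lambda$, such that $$\Phi(a+b)\le\lambda\Phi(a)+\frac{C}{(\lambda-1)^{p_\Phi^+-1}}\Phi(b)\qquad\text{for all } a,b\in[0,\infty)\text{ and all }\lambda\in(1,\Lambda].$$
   Context: An Orlicz function is a continuous convex function $\Phi:[0,\infty)\to[0,\infty)$ such that $\lim_{t\to0}\Phi(t)/t=0$, $\lim_{t\to\infty}\Phi(t)/t=\infty$, and there is a constant $C>0$ with $\Phi(2t)\le C\Phi(t)$ for all $t\ge0$ (the $\Delta_2$-condition). Such a $\Phi$ can be written $\Phi(t)=\int_0^t\varphi(s)\,ds$, where $\varphi$ (the right derivative of $\Phi$) is non-decreasing and right continuous on $[0,\infty)$, $\varphi(0)=0$, $\varphi(t)>0$ for $t>0$, and $\lim_{t\to\infty}\varphi(t)=\infty$. Define $p_\Phi^+:=\sup_{t>0}\frac{t\varphi(t)}{\Phi(t)}$, which is finite and at least $1$. *)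

(* Defs.v *)
From HB Require Import structures.
From mathcomp Require Import all_boot all_order all_algebra.
From mathcomp Require Import all_classical all_reals all_analysis.

Set Implicit Arguments.
Unset Strict Implicit.
Unset Printing Implicit Defensive.

Import Order.TTheory GRing.Theory Num.Theory.
Import numFieldNormedType.Exports.

Local Open Scope classical_set_scope.
Local Open Scope ring_scope.

(* A function [0, +oo[ -> [0, +oo[ is represented by a total function on R;
   only its values on [0, +oo[ are constrained or used below. *)
Record orlicz_function (R : realType) (Phi : R -> R) : Prop := OrliczFunction {
  orlicz_ge0 : forall t : R, 0 <= t -> 0 <= Phi t;
  orlicz_continuous : {within `[0, +oo[%classic, continuous Phi};
  orlicz_convex :
    @convex_function R R^o (`[0, +oo[%classic : set R) Phi;
  orlicz_lim0 : Phi t / t @[t --> 0^'+] --> (0 : R);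
  orlicz_limy : Phi t / t @[t --> +oo] --> +oo;
  orlicz_Delta2 : exists2 C : R, 0 < C &
    forall t : R, 0 <= t -> Phi (2 * t) <= C * Phi t
}.

(* For Phi convex on [0, +oo[ the limit exists at every t > 0. *)
Definition right_derivative (R : realType) (Phi : R -> R) (t : R) : R :=
  lim ((Phi (t + h) - Phi t) / h @[h --> 0^'+]).

(* The set is nonempty and, by the Delta_2-condition, bounded above when Phi is
   an Orlicz function, so that the real-valued [sup] is its actual supremum. *)
Definition upper_index (R : realType) (Phi : R -> R) : R :=
  sup [set t * right_derivative Phi t / Phi t | t in `]0, +oo[%classic].

(* Main.v *)
Require Import Defs.
From HB Require Import structures.
From mathcomp Require Import all_boot all_order all_algebra.
From mathcomp Require Import all_classical all_reals all_analysis.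
From mathcomp Require Import ring lra.

Import Order.TTheory GRing.Theory Num.Theory.
Import numFieldNormedType.Exports.

Local Open Scope classical_set_scope.
Local Open Scope ring_scope.

(** The exponent [p = upper_index Phi] enters through the power growth
    [Phi (s * t) <= s `^ p * Phi t] for [1 <= s] ([orlicz_growth]).  The
    inequality [t * phi t <= p * Phi t] says that [ln Phi] has logarithmic slope
    at most [p].  Convexity makes this usable without integrating [phi]: the
    right derivative is a subgradient at [t], so going back from [t] to [u]
    costs at most the relative amount [p * (1 - u / t)]
    ([orlicz_ge_tangent]).  Chaining [n] such steps along the geometric
    progression from [t] to [s * t] and letting [n] tend to infinity gives the
    power [s `^ p] ([powR_growth]).

    For any [tau > 0], the sum [a + b] is the convex combination of
    [(1 + tau) * a] and [(1 + tau) / tau * b] with weights [1 / (1 + tau)] and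
    [tau / (1 + tau)].  Convexity, then power growth at both points, where each
    weight cancels one factor of the power, yields ([orlicz_split])
    [Phi (a + b) <= (1 + tau) `^ (p - 1) * Phi a
                  + ((1 + tau) / tau) `^ (p - 1) * Phi b].
    It remains to take [tau] proportional to [lambda - 1], small enough for
    the first coefficient to be at most [lambda]: since
    [(1 + tau) `^ (p - 1) <= expR (p * tau)] and
    [ln lambda >= (lambda - 1) / Lambda], the choice
    [tau = (lambda - 1) / (p * Lambda)] works ([powR_1D_le]), and the second
    coefficient is then at most
    [Lambda * (p * Lambda) `^ (p - 1) / (lambda - 1) `^ (p - 1)]. *)

(** * Right derivatives of convex functions on the half-line *)

Lemma convex_halfline_le (R : realType) (f : R -> R)
    (cvx : @convex_function R R^o (`[0, +oo[%classic : set R) f) (c x y : R) :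
  0 <= c <= 1 -> 0 <= x -> 0 <= y ->
  f (c * x + (1 - c) * y) <= c * f x + (1 - c) * f y.
Proof.
move=> /andP[c0 c1] x0 y0.
have /= := cvx (Itv01 c0 c1) x y _ _.
by rewrite !inE/= !in_itv/= !andbT; exact.
Qed.

Lemma convex_slope_le (R : realType) (f : R -> R)
    (cvx : @convex_function R R^o (`[0, +oo[%classic : set R) f) (t h k : R) :
  0 <= t -> 0 < h -> h <= k -> (f (t + h) - f t) / h <= (f (t + k) - f t) / k.
Proof.
move=> t0 h0 hk; have k0 : 0 < k by exact: lt_le_trans hk.
have c01 : 0 <= h / k <= 1.
  by rewrite divr_ge0 ?(ltW h0) ?(ltW k0)//= ler_pdivrMr// mul1r.
have := convex_halfline_le _ _ cvx _ (t + k) t c01 (addr_ge0 t0 (ltW k0)) t0.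
rewrite (_ : h / k * (t + k) + _ = t + h); last by field; exact: lt0r_neq0.
move=> le; rewrite ler_pdivrMr//.
rewrite (_ : _ / k * h = h / k * f (t + k) + (1 - h / k) * f t - f t).
  by rewrite lerD2r.
by field; exact: lt0r_neq0.
Qed.

Lemma convex_three_slopes (R : realType) (f : R -> R)
    (cvx : @convex_function R R^o (`[0, +oo[%classic : set R) f) (u t h : R) :
  0 <= u -> u < t -> 0 < h -> (f t - f u) / (t - u) <= (f (t + h) - f t) / h.
Proof.
move=> u0 ut h0.
have tu0 : 0 < t - u by rewrite subr_gt0.
have tuh0 : 0 < t - u + h by exact: addr_gt0.
have := convex_slope_le _ _ cvx u (t - u) (t - u + h) u0 tu0.
rewrite lerDl (ltW h0) subrKC [u + _]addrA subrKC => /(_ isT).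
move=> le; rewrite ler_pdivlMr// mulrAC ler_pdivrMr//.
by move: le; rewrite ler_pdivlMr// mulrAC ler_pdivrMr//; lra.
Qed.

(** The difference quotients decrease as [h] decreases to 0, and any chord to the
    left of [t], here the one from 0, bounds them from below. *)
Lemma is_cvg_right_derivative (R : realType) (f : R -> R)
    (cvx : @convex_function R R^o (`[0, +oo[%classic : set R) f) (t : R) :
  0 < t -> cvg ((f (t + h) - f t) / h @[h --> 0^'+]).
Proof.
move=> t0; apply: nondecreasing_at_right_is_cvgr; near=> x.
  move=> h k; rewrite !in_itv/= => /andP[h0 _] _ hk.
  exact: (convex_slope_le _ _ cvx) (ltW t0) h0 hk.
exists ((f t - f 0) / (t - 0)) => y [h /=]; rewrite in_itv/= => /andP[h0 _] <-.
exact: (convex_three_slopes _ _ cvx).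
Unshelve. all: by end_near. Qed.

(** This makes the right derivative a subgradient on the left of [t] as well, even
    where [f] is not differentiable. *)
Lemma right_derivative_ge (R : realType) (f : R -> R)
    (cvx : @convex_function R R^o (`[0, +oo[%classic : set R) f) (u t : R) :
  0 <= u -> u < t -> (f t - f u) / (t - u) <= right_derivative f t.
Proof.
move=> u0 ut; apply: limr_ge.
  exact: (is_cvg_right_derivative _ _ cvx) (le_lt_trans u0 ut).
by near=> h; exact: (convex_three_slopes _ _ cvx).
Unshelve. all: by end_near. Qed.

Lemma right_derivative_le (R : realType) (f : R -> R)
    (cvx : @convex_function R R^o (`[0, +oo[%classic : set R) f) (t k : R) :
  0 < t -> 0 < k -> right_derivative f t <= (f (t + k) - f t) / k.
Proof.
move=> t0 k0; apply: limr_le; first exact: (is_cvg_right_derivative _ _ cvx).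
near=> h; apply: (convex_slope_le _ _ cvx) (ltW t0) _ _.
- by near: h; exact: nbhs_right_gt.
- by near: h; exact: nbhs_right_le.
Unshelve. all: by end_near. Qed.

(** * Orlicz functions and their upper index *)

(** The limit of [Phi t / t] forces [Phi] to tend to 0 at 0, and continuity
    transfers this to the value at 0, which convexity alone would allow to be
    larger. *)
Lemma orlicz0 (R : realType) (Phi : R -> R) (hPhi : orlicz_function Phi) :
  Phi 0 = 0.
Proof.
have [_ cv0] := (continuous_within_itvcyP _ _).1 (orlicz_continuous hPhi).
have cv_id : x @[x --> (0 : R)^'+] --> (0 : R).
  by apply: cvg_at_right_filter; exact: cvg_id.
suff cvP : Phi x @[x --> 0^'+] --> (0 : R).
  exact: (cvg_unique (@Rhausdorff R) cv0 cvP).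
have := @cvgM _ _ _ (at_right_proper_filter 0) _ _ _ _ (orlicz_lim0 hPhi) cv_id.
rewrite mulr0.
apply: cvg_trans; apply: near_eq_cvg; near=> x.
by rewrite /= divfK// lt0r_neq0.
Unshelve. all: by end_near. Qed.

(** By the doubling condition a zero at [t] propagates to all [2 ^+ n * t], which
    contradicts superlinear growth at infinity. *)
Lemma orlicz_gt0 (R : realType) (Phi : R -> R) (hPhi : orlicz_function Phi)
    (t : R) : 0 < t -> 0 < Phi t.
Proof.
move=> t0; rewrite lt_neqAle orlicz_ge0 ?ltW// andbT eq_sym; apply/eqP => Pt0.
have [C _ D2] := orlicz_Delta2 hPhi.
have P0 n : Phi (2 ^+ n * t) = 0.
  elim: n => [|n IH]; first by rewrite mul1r.
  have x0 : 0 <= 2 ^+ n * t by rewrite mulr_ge0 ?exprn_ge0// ltW.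
  rewrite exprS -mulrA; apply: le_anti; apply/andP; split.
    by rewrite (le_trans (D2 _ x0))// IH mulr0.
  by rewrite (orlicz_ge0 hPhi)// mulr_ge0.
have /cvgryPge/(_ 1)[M [_ HM]] := orlicz_limy hPhi.
pose n := Num.bound `|M / t|.
have Mn : M < 2 ^+ n * t.
  rewrite -ltr_pdivrMr// (le_lt_trans (ler_norm _))//.
  apply: lt_trans (archi_boundP (normr_ge0 _)) _.
  by rewrite -natrX ltr_nat ltn_expl.
by have := HM _ Mn; rewrite /= P0 mul0r ler10.
Qed.

(** A real [sup] dominates its set only if that set is bounded: the chord from [x]
    to [2 * x] together with the doubling condition supplies the bound [C - 1]. *)
Lemma upper_index_ub (R : realType) (Phi : R -> R)
    (hPhi : orlicz_function Phi) (t : R) :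
  0 < t -> t * right_derivative Phi t / Phi t <= upper_index Phi.
Proof.
move=> t0; apply: ub_le_sup; last by exists t => //=; rewrite in_itv/= t0.
have [C _ D2] := orlicz_Delta2 hPhi.
exists (C - 1) => y [x /=]; rewrite in_itv/= andbT => x0 <-.
rewrite ler_pdivrMr ?orlicz_gt0//.
have := right_derivative_le _ _ (orlicz_convex hPhi) x x x0 x0.
rewrite ler_pdivlMr// -mulr2n -mulr_natl => le.
have := D2 _ (ltW x0); lra.
Qed.

Lemma upper_index_ge1 (R : realType) (Phi : R -> R)
    (hPhi : orlicz_function Phi) : 1 <= upper_index Phi.
Proof.
apply: le_trans (upper_index_ub _ _ hPhi 1 ltr01).
have := right_derivative_ge _ _ (orlicz_convex hPhi) 0 1 (lexx _) ltr01.
rewrite (orlicz0 _ _ hPhi) !subr0 divr1 => le.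
by rewrite ler_pdivlMr ?orlicz_gt0// !mul1r.
Qed.

(** The tangent line at [t] with slope [right_derivative Phi t], which is at most
    [upper_index Phi * Phi t / t], stays below [Phi] on the left of [t]. *)
Lemma orlicz_ge_tangent (R : realType) (Phi : R -> R)
    (hPhi : orlicz_function Phi) (u t : R) :
  0 < u -> u <= t -> Phi t * (1 - upper_index Phi * (1 - u / t)) <= Phi u.
Proof.
move=> u0; rewrite le_eqVlt => /predU1P[<-|ut].
  by rewrite divff ?lt0r_neq0// subrr mulr0 subr0 mulr1.
have t0 := lt_trans u0 ut.
have := upper_index_ub _ _ hPhi t t0.
rewrite ler_pdivrMr ?orlicz_gt0// => ub.
have := right_derivative_ge _ _ (orlicz_convex hPhi) u t (ltW u0) ut.
rewrite ler_pdivrMr ?subr_gt0// => tg.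
have ut1 : 0 <= 1 - u / t by rewrite subr_ge0 ler_pdivrMr// mul1r ltW.
have := ler_wpM2r ut1 ub.
rewrite (_ : t * _ * (1 - u / t) = right_derivative Phi t * (t - u)).
  by lra.
by field; exact: lt0r_neq0.
Qed.

(** * Power growth *)

(** One step of the chain, with ratio [expR h]: the loss [1 - expR (- h)] is at
    most [h], and [- ln (1 - x) <= x / (1 - x)]. *)
Lemma ln_growth_step (R : realType) (f : R -> R) (p : R) (p0 : 0 <= p)
    (fgt0 : forall t, 0 < t -> 0 < f t)
    (f_ge : forall u t, 0 < u -> u <= t -> f t * (1 - p * (1 - u / t)) <= f u)
    (h v : R) :
  0 <= h -> p * h < 1 -> 0 < v ->
  ln (f (expR h * v)) <= ln (f v) + p * h / (1 - p * h).
Proof.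
move=> h0 ph1 v0.
have eh1 : 1 <= expR h by rewrite -expR0 ler_expR.
have w0 : 0 < expR h * v by rewrite mulr_gt0 ?expR_gt0.
have le : f (expR h * v) * (1 - p * h) <= f v.
  apply: le_trans (f_ge v (expR h * v) v0 _); last by rewrite ler_peMl// ltW.
  rewrite (ler_wpM2l (ltW (fgt0 _ w0)))// lerD2l lerN2 (ler_wpM2l p0)//.
  rewrite invfM mulrCA divff ?lt0r_neq0// mulr1 -expRN.
  by have := expR_ge1Dx (- h); lra.
have d0 : 0 < 1 - p * h by rewrite subr_gt0.
rewrite -lerBlDl -ln_div ?posrE ?fgt0//.
set x := p * h / _.
have x0 : 0 <= x by rewrite divr_ge0 ?mulr_ge0// ltW.
apply: le_trans (le_ln1Dx (lt_le_trans (ltrN10 R) x0)).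
rewrite ler_ln ?posrE ?divr_gt0 ?fgt0//; last by rewrite ltr_wpDr.
rewrite (_ : 1 + x = (1 - p * h)^-1).
  by rewrite ler_pdivrMr ?fgt0// [leRHS]mulrC ler_pdivlMr.
by rewrite /x; field; exact: lt0r_neq0.
Qed.

(** An integration of the differential inequality [t * f' <= p * f] that uses only
    its one-sided, discrete form.  With [L = ln s] and [n] steps of size [L / n]
    the increment of [ln f] is at most [p * L / (1 - p * L / n)], hence at most
    [p * L] in the limit. *)
Lemma powR_growth (R : realType) (f : R -> R) (p : R) (p0 : 0 <= p)
    (fgt0 : forall t, 0 < t -> 0 < f t)
    (f_ge : forall u t, 0 < u -> u <= t -> f t * (1 - p * (1 - u / t)) <= f u)
    (s t : R) :
  1 <= s -> 0 < t -> f (s * t) <= s `^ p * f t.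
Proof.
move=> s1 t0; have s0 : 0 < s by exact: lt_le_trans s1.
pose L := ln s; have L0 : 0 <= L by exact: ln_ge0.
have iter_step h n : 0 <= h -> p * h < 1 ->
    ln (f (expR (n%:R * h) * t)) <= ln (f t) + n%:R * (p * h / (1 - p * h)).
  move=> h0 ph1; elim: n => [|n IH]; first by rewrite !mul0r expR0 mul1r addr0.
  rewrite -natr1 !mulrDl !mul1r addrC expRD -mulrA addrA.
  apply: le_trans (lerD IH (lexx _)).
  apply: (ln_growth_step _ _ _ p0 fgt0 f_ge) => //.
  by rewrite mulr_gt0 ?expR_gt0.
pose D := ln (f (s * t)) - ln (f t).
have DL n : p * L < n%:R -> D * (1 - p * L / n%:R) <= p * L.
  move=> pLn; have n0 : 0 < n%:R :> R by apply: le_lt_trans pLn; rewrite mulr_ge0.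
  have d0 : p * (L / n%:R) < 1 by rewrite mulrA ltr_pdivrMr// mul1r.
  have := iter_step (L / n%:R) n (divr_ge0 L0 (ltW n0)) d0.
  rewrite mulrCA divff ?lt0r_neq0// mulr1 lnK ?posrE// -lerBlDl -/D.
  rewrite (mulrA p) mulrA mulrCA divff ?lt0r_neq0// mulr1.
  by rewrite ler_pdivlMr ?subr_gt0// -mulrA.
have DpL : D <= p * L.
  rewrite leNgt; apply/negP => pLD.
  have e0 : 0 < D - p * L by rewrite subr_gt0.
  (* The two summands ensure that [DL] applies at [n], and that its error term
     [D * (p * L) / n] is smaller than the gap [D - p * L]. *)
  pose n := Num.bound (p * L + D * (p * L) / (D - p * L)).
  have pL0 : 0 <= p * L by rewrite mulr_ge0.
  have D0 : 0 < D by exact: le_lt_trans pLD.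
  have q0 : 0 <= D * (p * L) / (D - p * L).
    by rewrite divr_ge0 ?mulr_ge0// ltW.
  have nb : p * L + D * (p * L) / (D - p * L) < n%:R.
    by apply: archi_boundP; exact: addr_ge0.
  have pLn : p * L < n%:R by apply: le_lt_trans nb; rewrite lerDl.
  have n0 : 0 < n%:R :> R by exact: (le_lt_trans pL0 pLn).
  have : D * (p * L) / n%:R < D - p * L.
    rewrite ltr_pdivrMr// [ltRHS]mulrC -ltr_pdivrMr//.
    by apply: le_lt_trans nb; rewrite lerDr.
  by have := DL _ pLn; rewrite mulrBr mulr1 mulrA; lra.
rewrite -ler_ln ?posrE ?mulr_gt0 ?powR_gt0 ?fgt0 ?mulr_gt0//.
by rewrite lnM ?posrE ?powR_gt0 ?fgt0// ln_powR -/L -lerBlDr.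
Qed.

Lemma orlicz_growth (R : realType) (Phi : R -> R)
    (hPhi : orlicz_function Phi) (s t : R) :
  1 <= s -> 0 <= t -> Phi (s * t) <= s `^ upper_index Phi * Phi t.
Proof.
move=> s1; rewrite le_eqVlt => /predU1P[<-|t0].
  by rewrite mulr0 (orlicz0 _ _ hPhi) mulr0.
apply: powR_growth => //.
- exact: le_trans ler01 (upper_index_ge1 _ _ hPhi).
- exact: orlicz_gt0.
- exact: orlicz_ge_tangent.
Qed.

(** * Splitting a sum *)

(** Splitting with a free parameter: small [tau] brings the coefficient of [Phi a]
    close to 1 at the expense of that of [Phi b]. *)
Lemma orlicz_split (R : realType) (Phi : R -> R)
    (hPhi : orlicz_function Phi) (a b tau : R) :
  0 <= a -> 0 <= b -> 0 < tau ->
  Phi (a + b) <= (1 + tau) `^ (upper_index Phi - 1) * Phi a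
               + ((1 + tau) / tau) `^ (upper_index Phi - 1) * Phi b.
Proof.
move=> a0 b0 tau0; set p := upper_index Phi.
have p0 : 0 < p by exact: lt_le_trans (upper_index_ge1 _ _ hPhi).
have sgt0 : 0 < 1 + tau by lra.
have rescale s x : 1 <= s -> 0 <= x ->
    s^-1 * Phi (s * x) <= s `^ (p - 1) * Phi x.
  move=> s1 x0; have s0 : 0 < s by exact: lt_le_trans s1.
  rewrite ler_pdivrMl// mulrA mulr_powRB1 ?(ltW s0)//.
  exact: orlicz_growth.
have s1 : 1 <= 1 + tau by lra.
have r1 : 1 <= (1 + tau) / tau by rewrite ler_pdivlMr//; lra.
apply: le_trans (lerD (rescale _ _ s1 a0) (rescale _ _ r1 b0)).
rewrite (_ : ((1 + tau) / tau)^-1 = 1 - (1 + tau)^-1); last first.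
  by field; rewrite !lt0r_neq0.
rewrite [X in Phi X <= _](_ : _ = (1 + tau)^-1 * ((1 + tau) * a)
    + (1 - (1 + tau)^-1) * ((1 + tau) / tau * b)); last first.
  by field; rewrite !lt0r_neq0.
apply: (convex_halfline_le _ _ (orlicz_convex hPhi)).
- by rewrite invr_ge0 ltW//= invf_le1.
- by rewrite mulr_ge0// ltW.
- by rewrite mulr_ge0 ?divr_ge0// ltW.
Qed.

(** Taking logarithms, [(p - 1) * ln (1 + tau) <= p * tau], which is
    [(lambda - 1) / Lambda] and so at most [1 - lambda^-1 <= ln lambda]. *)
Lemma powR_1D_le (R : realType) (p lambda Lambda : R) :
  0 < p -> 1 < lambda <= Lambda ->
  (1 + (lambda - 1) / (p * Lambda)) `^ (p - 1) <= lambda.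
Proof.
move=> p0 /andP[l1 lL]; set tau := _ / _.
have l0 : 0 < lambda by exact: lt_trans l1.
have L0 : 0 < Lambda by exact: lt_le_trans lL.
have tau0 : 0 <= tau by rewrite divr_ge0 ?mulr_ge0 ?subr_ge0// ltW.
have s0 : 0 < 1 + tau by rewrite ltr_wpDr.
rewrite -ler_ln ?posrE ?powR_gt0// ln_powR.
have ln_le : ln (1 + tau) <= tau by apply: le_ln1Dx; exact: lt_le_trans tau0.
have ln_s0 : 0 <= ln (1 + tau) by apply: ln_ge0; rewrite lerDl.
have ln_lambda : 1 - lambda^-1 <= ln lambda.
  have i1 : -1 < lambda^-1 - 1.
    by rewrite ltrBrDr addNr invr_gt0.
  have := le_ln1Dx i1; rewrite addrCA subrr addr0 lnV ?posrE//; lra.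
apply: le_trans ln_lambda.
have : p * tau <= 1 - lambda^-1.
  rewrite /tau invfM mulrCA [p * _]mulrA divff ?lt0r_neq0// mul1r.
  rewrite (_ : 1 - lambda^-1 = (lambda - 1) / lambda); last first.
    by field; exact: lt0r_neq0.
  by rewrite ler_wpM2l ?subr_ge0 ?(ltW l1)// lef_pV2 ?posrE.
apply: le_trans; apply: (@le_trans _ _ (p * ln (1 + tau))).
  by rewrite ler_wpM2r//; lra.
by rewrite ler_wpM2l// ltW.
Qed.

Theorem lemma3p1 (R : realType) (Phi : R -> R) (hPhi : orlicz_function Phi)
    (Lambda : R) (hLambda : 1 < Lambda) :
  exists2 C : R, 0 < C &
    forall a b lambda : R, 0 <= a -> 0 <= b -> 1 < lambda <= Lambda ->
      Phi (a + b) <=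
        lambda * Phi a + C / ((lambda - 1) `^ (upper_index Phi - 1)) * Phi b.
Proof.
set p := upper_index Phi.
have p0 : 0 < p by exact: lt_le_trans (upper_index_ge1 _ _ hPhi).
have L0 : 0 < Lambda by exact: lt_trans hLambda.
have pL0 : 0 < p * Lambda by exact: mulr_gt0.
exists (Lambda * (p * Lambda) `^ (p - 1)); first by rewrite mulr_gt0 ?powR_gt0.
move=> a b lambda a0 b0 lambdaP.
have s_le := powR_1D_le _ _ _ _ p0 lambdaP.
have /andP[l1 lL] := lambdaP.
set tau := (lambda - 1) / (p * Lambda) in s_le.
have tau0 : 0 < tau by rewrite divr_gt0 ?subr_gt0.
apply: le_trans (orlicz_split _ _ hPhi _ _ _ a0 b0 tau0) _; rewrite -/p.
apply: lerD; apply: ler_wpM2r; rewrite ?orlicz_ge0//.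
have powRV (x : R) : 0 <= x -> x^-1 `^ (p - 1) = (x `^ (p - 1))^-1.
  by move=> x0; rewrite -[x^-1]powR_inv1// powRAC powR_inv1// powR_ge0.
have tauE : tau^-1 `^ (p - 1)
    = (p * Lambda) `^ (p - 1) / (lambda - 1) `^ (p - 1).
  have d0 : 0 <= lambda - 1 by rewrite subr_ge0 ltW.
  by rewrite /tau invf_div [LHS]powRM ?invr_ge0 ?(ltW pL0)// powRV.
rewrite powRM ?invr_ge0 ?addr_ge0 ?ler01 ?(ltW tau0)// tauE -[leRHS]mulrA.
by rewrite ler_wpM2r ?divr_ge0 ?powR_ge0// (le_trans s_le).
Qed.
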